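(* Let $B$ be a separable Banach space, $\chi$ a Chi-subspace of $(B\hat{\otimes}_{\pi}B)^{\ast}$, and let $\mathbb X^{1},\mathbb X^{2}$ be two continuous $B$-valued stochastic processes indexed by $[0,T]$ such that, for every $i,j\in\{1,2\}$, $\mathbb X^{i}$ and $\mathbb X^{j}$ admit a $\chi$-covariation. Let $F^{1},F^{2}:B\to\mathbb R$ be of class $C^{1}$ in the Fréchet sense and suppose that, for $i,j\in\{1,2\}$, the maps $$B\times B\to\chi,\qquad (x,y)\mapsto DF^{i}(x)\otimes DF^{j}(y)$$ are well defined (i.e. take values in $\chi$) and continuous. Then for every $i,j\in\{1,2\}$ the covariation of the real processes $F^{i}(\mathbb X^{i})$ and $F^{j}(\mathbb X^{j})$ exists and $$[F^{i}(\mathbb X^{i}),F^{j}(\mathbb X^{j})]_t=\int_{0}^{t}\langle DF^{i}(\mathbb X^{i}_{s})\otimes DF^{j}(\mathbb X^{j}_{s}),d\widetilde{[\mathbb X^{i},\mathbb X^{j}]}_{s}\rangle,\quad t\in[0,T].$$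
   Context: Fix a probability space $(\Omega,\mathcal F,\mathbb P)$ and $T>0$. All processes indexed by $[0,T]$ are extended by $\mathbb X_t=\mathbb X_0$ for $t\le0$ and $\mathbb X_t=\mathbb X_T$ for $t\ge T$. Real covariation: for real processes $X,Y$ with $X$ continuous, set $[X,Y]^{\epsilon}_t=\int_0^t\frac{(X_{s+\epsilon}-X_s)(Y_{s+\epsilon}-Y_s)}{\epsilon}ds$; $X,Y$ admit a covariation if for each $t$ the limit in probability of $[X,Y]^\epsilon_t$ as $\epsilon\to0$ exists and the limit process has a continuous modification, denoted $[X,Y]$. For Banach spaces $B_1,B_2$, $B_1\hat\otimes_\pi B_2$ is the projective tensor product; its dual is identified with bounded bilinear forms on $B_1\times B_2$. A Chi-subspace is a Banach space $\chi$ continuously injected into $(B_1\hat\otimes_\pi B_2)^*$. For $S,T\in B^*$, $S\otimes T$ denotes the unique continuous linear form on $B\hat\otimes_\pi B$ with $S\otimes T(e_1\otimes e_2)=S(e_1)T(e_2)$. $\chi$-covariation: let $\mathbb X$ be continuous $B_1$-valued and $\mathbb Y$ strongly measurable $B_2$-valued with $\int_0^T\|\mathbb Y_s\|ds<\infty$ a.s. For $\phi\in\chi$ set $[\mathbb X,\mathbb Y]^\epsilon(\phi)_t=\int_0^t\langle\phi,\frac{(\mathbb X_{s+\epsilon}-\mathbb X_s)\otimes(\mathbb Y_{s+\epsilon}-\mathbb Y_s)}{\epsilon}\rangle ds$. $\mathbb X,\mathbb Y$ admit a $\chi$-covariation if (H1) for every sequence $\epsilon_n\to0$ there is a subsequence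 $(\epsilon_{n_k})$ with $\sup_k\int_0^T\frac{\|(\mathbb X_{s+\epsilon_{n_k}}-\mathbb X_s)\otimes(\mathbb Y_{s+\epsilon_{n_k}}-\mathbb Y_s)\|_{\chi^*}}{\epsilon_{n_k}}ds<\infty$ a.s.; and (H2) there is a map $\phi\mapsto[\mathbb X,\mathbb Y](\phi)$ from $\chi$ into continuous real processes with $[\mathbb X,\mathbb Y]^\epsilon(\phi)\to[\mathbb X,\mathbb Y](\phi)$ uniformly on $[0,T]$ in probability for every $\phi\in\chi$, and a measurable $\chi^*$-valued process $\widetilde{[\mathbb X,\mathbb Y]}$ whose paths are a.s. cadlag with bounded variation and such that $\widetilde{[\mathbb X,\mathbb Y]}_t(\phi)=[\mathbb X,\mathbb Y](\phi)_t$ a.s. for all $\phi\in\chi$, $t\in[0,T]$. $\widetilde{[\mathbb X,\mathbb Y]}$ is called the $\chi$-covariation. Integrals $\int_0^t\langle H_s,d\widetilde{[\mathbb X,\mathbb Y]}_s\rangle$ are pathwise Stieltjes (Bochner) integrals of the $\chi$-valued integrand against the $\chi^*$-valued bounded variation path. *)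

(* Defs.v *)
From HB Require Import structures.
From mathcomp Require Import all_boot all_order all_algebra.
From mathcomp Require Import all_classical all_reals all_analysis.
Import Order.TTheory GRing.Theory Num.Theory.
Import numFieldNormedType.Exports.

Set Implicit Arguments.
Unset Strict Implicit.
Unset Printing Implicit Defensive.

Local Open Scope classical_set_scope.
Local Open Scope ring_scope.

Section Defs.
Variable R : realType.

Definition extT (T : R) (V : Type) (f : R -> V) (t : R) : V :=
  f (Num.min T (Num.max 0 t)).

Definition itv0 (t : R) : set R := `[0, t].

Definition tint (t : R) (f : R -> R) : R :=
  Rintegral (@lebesgue_measure R) `[0, t] f.

Section Prob.
Context {d : measure_display} {Omega : measurableType d}.
Variable P : probability Omega R.

Definition outP_le (A : set Omega) (eta : R) : Prop :=
  exists2 M, measurable M & (A `<=` M /\ (P M <= eta%:E)%E).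

Definition cvg_prob0 (Y : R -> Omega -> R) (L : Omega -> R) : Prop :=
  forall delta eta : R, 0 < delta -> 0 < eta ->
  exists2 e0 : R, 0 < e0 & forall eps : R, 0 < eps -> eps < e0 ->
    outP_le [set w | delta < `|Y eps w - L w|] eta.

Definition ucp0 (T : R) (Y : R -> Omega -> R -> R) (L : Omega -> R -> R) : Prop :=
  forall delta eta : R, 0 < delta -> 0 < eta ->
  exists2 e0 : R, 0 < e0 & forall eps : R, 0 < eps -> eps < e0 ->
    outP_le [set w | exists t, 0 <= t <= T /\ delta < `|Y eps w t - L w t|] eta.
End Prob.

Definition real_cov_eps (T : R) {Omega : Type} (X Y : Omega -> R -> R)
    (eps : R) (w : Omega) (t : R) : R :=
  tint t (fun s => (extT T (X w) (s + eps) - extT T (X w) s) *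
                   (extT T (Y w) (s + eps) - extT T (Y w) s) / eps).

Definition is_real_cov {d : measure_display} {Omega : measurableType d}
    (P : probability Omega R) (T : R) (X Y : Omega -> R -> R)
    (Q : Omega -> R -> R) : Prop :=
  (forall w, {within `[0, T], continuous (Q w)}) /\
  forall t, 0 <= t <= T ->
    cvg_prob0 P (fun eps w => real_cov_eps T X Y eps w t) (fun w => Q w t).

Section Banach.
Variable B : normedModType R.

Definition separable_space : Prop :=
  exists D : set B, countable D /\ closure D = setT.

Definition frechet_C1 (F : B -> R) : Prop :=
  (forall x, differentiable F x) /\
  forall x (e : R), 0 < e -> exists2 del : R, 0 < del &
    forall y, `|y - x| < del -> forall h, `|'d F y h - 'd F x h| <= e * `|h|.

(* bounded bilinear forms on B x B = dual of the projective tensor product *)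
Definition bounded_bilinear (b : B -> B -> R) : Prop :=
  (forall (k : R) a a' c, b (k *: a + a') c = k * b a c + b a' c) /\
  (forall (k : R) a c c', b a (k *: c + c') = k * b a c + b a c') /\
  exists M : R, forall a c, `|b a c| <= M * `|a| * `|c|.

Section Chi.
Variable chi : normedModType R.
(* iota : chi -> (B \hat\otimes_pi B)^*, the latter identified with bounded
   bilinear forms on B x B *)
Variable iota : chi -> B -> B -> R.

Definition chi_subspace : Prop :=
  (forall phi, bounded_bilinear (iota phi)) /\
  (forall (k : R) phi psi a c,
      iota (k *: phi + psi) a c = k * iota phi a c + iota psi a c) /\
  injective iota /\
  (exists M : R, forall phi a c, `|iota phi a c| <= M * `|phi| * `|a| * `|c|).

Definition in_chi_dual (z : chi -> R) : Prop :=
  (forall (k : R) phi psi, z (k *: phi + psi) = k * z phi + z psi) /\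
  exists M : R, forall phi, `|z phi| <= M * `|phi|.

Definition dnorm (z : chi -> R) : R := sup [set `|z phi| | phi in [set phi : chi | `|phi| <= 1]].

Definition dsub (z z' : chi -> R) : chi -> R := fun phi => z phi - z' phi.

Definition tens (a c : B) : chi -> R := fun phi => iota phi a c.

Definition dual_open (U : set (chi -> R)) : Prop :=
  forall z, U z -> in_chi_dual z -> exists2 r : R, 0 < r &
    forall z', in_chi_dual z' -> dnorm (dsub z' z) < r -> U z'.

Definition partition (a b : R) (s : seq R) : Prop :=
  [/\ (0 < size s)%N, head 0 s = a, last 0 s = b & sorted <%R s].

Definition dual_cadlag (T : R) (Z : R -> chi -> R) : Prop :=
  (forall t, 0 <= t < T -> forall e : R, 0 < e -> exists2 del : R, 0 < del &
     forall u, t <= u < t + del -> dnorm (dsub (Z u) (Z t)) < e) /\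
  (forall t, 0 < t <= T -> exists L, in_chi_dual L /\
     forall e : R, 0 < e -> exists2 del : R, 0 < del &
       forall u, t - del < u < t -> dnorm (dsub (Z u) L) < e).

Definition dual_bv (T : R) (Z : R -> chi -> R) : Prop :=
  exists M : R, forall s, partition 0 T s ->
    \sum_(k < (size s).-1) dnorm (dsub (Z (nth 0 s k.+1)) (Z (nth 0 s k))) <= M.

Definition is_RS_integral (H : R -> chi) (Z : R -> chi -> R) (t I : R) : Prop :=
  forall e : R, 0 < e -> exists2 del : R, 0 < del &
    forall (s : seq R) (xi : nat -> R), partition 0 t s ->
      (forall k, (k < (size s).-1)%N ->
          nth 0 s k.+1 - nth 0 s k < del /\ nth 0 s k <= xi k <= nth 0 s k.+1) ->
      `|\sum_(k < (size s).-1) (Z (nth 0 s k.+1) (H (xi k)) - Z (nth 0 s k) (H (xi k)))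
         - I| < e.

Section ChiCov.
Context {d : measure_display} {Omega : measurableType d}.
Variable P : probability Omega R.
Variable T : R.

Definition chi_cov_eps (X Y : Omega -> R -> B) (phi : chi) (eps : R)
    (w : Omega) (t : R) : R :=
  tint t (fun s => iota phi (extT T (X w) (s + eps) - extT T (X w) s)
                            (extT T (Y w) (s + eps) - extT T (Y w) s) / eps).

Definition chiH1 (X Y : Omega -> R -> B) : Prop :=
  forall epsn : nat -> R, (forall n, 0 < epsn n) -> epsn @ \oo --> (0 : R) ->
  exists sig : nat -> nat, (forall n, (sig n < sig n.+1)%N) /\
    {ae P, forall w, exists M : R, forall k,
      (\int[@lebesgue_measure R]_(s in itv0 T)
          (dnorm (tens (extT T (X w) (s + epsn (sig k)) - extT T (X w) s)
                       (extT T (Y w) (s + epsn (sig k)) - extT T (Y w) s))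
           / epsn (sig k))%:E <= M%:E)%E}.

Definition is_chi_cov (X Y : Omega -> R -> B) (Z : Omega -> R -> chi -> R) : Prop :=
  chiH1 X Y /\
  exists C : chi -> Omega -> R -> R,
    (forall phi w, {within `[0, T], continuous (C phi w)}) /\
    (forall phi, ucp0 P T (chi_cov_eps X Y phi) (C phi)) /\
    [/\ (forall w t, in_chi_dual (Z w t)),
        (forall U, dual_open U ->
           measurable [set p : Omega * R | 0 <= p.2 <= T /\ U (Z p.1 p.2)]),
        {ae P, forall w, dual_cadlag T (Z w) /\ dual_bv T (Z w)} &
        (forall phi t, 0 <= t <= T -> {ae P, forall w, Z w t phi = C phi w t})].

Definition admits_chi_cov (X Y : Omega -> R -> B) : Prop :=
  exists Z, is_chi_cov X Y Z.
End ChiCov.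
End Chi.
End Banach.
End Defs.

(* Main.v *)
Require Import Defs.
From HB Require Import structures.
From mathcomp Require Import all_boot all_order all_algebra.
From mathcomp Require Import all_classical all_reals all_analysis.
From mathcomp Require Import measurable_realfun ring lra.
Import Order.TTheory GRing.Theory Num.Theory.
Import numFieldNormedType.Exports.
Set Implicit Arguments.
Unset Strict Implicit.
Unset Printing Implicit Defensive.

Local Open Scope classical_set_scope.
Local Open Scope ring_scope.

(* By the mean value theorem the product of the increments of F^i(X^i) and
   F^j(X^j) over [s, s + eps] is exactly <G(a, c), dX^i (x) dX^j> for some a, c
   on the segments joining the two values of X^i and of X^j, where G = DF^i (x) DF^j.
   Since G is uniformly continuous around the compact path, replacing G(a, c) by
   H_u = G(X^i_u, X^j_u) with u close to s costs at most
   e * ||dX^i (x) dX^j||_{chi^*}, whose integral divided by eps is bounded along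
   a subsequence by (H1).
   Freezing H on the intervals of a partition and letting eps -> 0 with (H2),
   used on a countable set of phi dense in the range of G, the regularized
   covariation differs in the limit from every Riemann-Stieltjes sum of fine mesh
   by at most e * M. Hence it converges and its limit is the Riemann-Stieltjes
   integral. As every sequence of scales has a subsequence along which this holds
   almost surely, the convergence holds in probability. *)

(** * Uniform continuity along a compact path *)

(** The point [q] ranges over all of [U], since it will be a pair of mean value points lying off the
    path. Balls of [U] need not be compact, so compactness of [a, b] is used: a radius valid at
    [c u] is halved to serve every [c u'] with [u'] near [u]. *)
Lemma heine_segment (R : realType) (U V : normedModType R) (c : R -> U)
    (g : U -> V) (a b : R) :
  continuous c -> continuous g ->
  forall e : R, 0 < e -> exists2 del : R, 0 < del &
    forall u, a <= u <= b -> forall q, `|q - c u| < del -> `|g q - g (c u)| < e.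
Proof.
move=> cc cg e e0.
have /compact_near_coveringP/(_ R (0 : R)^'+
    (fun r u => forall q, `|q - c u| < r -> `|g q - g (c u)| < e)) :
  compact `[a, b]%classic by exact: segment_compact.
have e20 : 0 < e / 2 by rewrite divr_gt0.
move=> H; have {H} hA : \forall r \near (0 : R)^'+, `[a, b] `<=`
    (fun u => forall q, `|q - c u| < r -> `|g q - g (c u)| < e).
  apply: H => u _.
  have /cvgrPdist_lt/(_ _ e20)/nbhs_ballP[r /= r0 hr] := cg (c u).
  have r20 : 0 < r / 2 by rewrite divr_gt0.
  have /cvgrPdist_lt/(_ _ r20) hc := cc u.
  near=> u' r' => q /= qr.
  have hu : `|c u - c u'| < r / 2 by near: u'; exact: hc.
  have r'r : r' < r / 2 by near: r'; exact: nbhs_right_lt.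
  have h1 : `|g (c u) - g q| < e / 2.
    apply: hr; rewrite -ball_normE /=.
    rewrite (_ : c u - q = (c u - c u') + (c u' - q)); last by rewrite subrKA.
    rewrite (le_lt_trans (ler_normD _ _))// (splitr r) ltrD//.
    by rewrite distrC (lt_trans qr).
  have h2 : `|g (c u) - g (c u')| < e / 2.
    apply: hr; rewrite -ball_normE /= (lt_trans hu)//.
    by rewrite ltr_pdivrMr// ltr_pMr// ltr1n.
  rewrite (_ : g q - g (c u') = (g q - g (c u)) + (g (c u) - g (c u'))); last first.
    by rewrite subrKA.
  by rewrite (le_lt_trans (ler_normD _ _))// (splitr e) ltrD// distrC.
near (0 : R)^'+ => r.
exists r => // u uab q; apply: (near hA r) => //=.
Unshelve. all: by end_near. Qed.

(** * Integrals of continuous functions over [0, t] *)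

Section tint.
Variable R : realType.
Implicit Types f g : R -> R.
Let mu := @lebesgue_measure R.

Lemma continuous_integrable_segment f (a b : R) : continuous f ->
  mu.-integrable `[a, b] (EFin \o f).
Proof.
move=> cf; apply: continuous_compact_integrable; first exact: segment_compact.
by apply: continuous_subspaceT.
Qed.

Lemma tintB f g t : continuous f -> continuous g ->
  tint t (fun s => f s - g s) = tint t f - tint t g.
Proof.
by move=> cf cg; apply: RintegralB => //; exact: continuous_integrable_segment.
Qed.

Lemma tintZ f (c t : R) : continuous f -> tint t (fun s => c * f s) = c * tint t f.
Proof.
by move=> cf; apply: RintegralZl => //; exact: continuous_integrable_segment.
Qed.

Lemma tint0 f : tint 0 f = 0.
Proof. by rewrite /tint set_itv1 Rintegral_set1. Qed.

Lemma tint_cst (c t : R) : 0 <= t -> tint t (fun=> c) = c * t.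
Proof.
by move=> t0; rewrite /tint Rintegral_cst//= lebesgue_measure_itv/= lte_fin;
  case: ltP => [_|t0']; rewrite /= ?subr0//; congr (_ * _); apply/eqP;
  rewrite eq_le t0 t0'.
Qed.

(** Differences of [tint] stand for integrals over [a, b], so that later statements only involve
    integrals from 0, as the covariations do. *)
Lemma tint_incr_le f g (a b : R) : continuous f -> continuous g ->
  0 <= a -> a <= b -> (forall s, a <= s <= b -> f s <= g s) ->
  tint b f - tint a f <= tint b g - tint a g.
Proof.
move=> cf cg a0 ab fg; rewrite /tint !Rintegral_itvB ?bnd_simp//; last 2 first.
- exact: continuous_integrable_segment.
- exact: continuous_integrable_segment.
have i h : continuous h -> mu.-integrable `]a, b] (EFin \o h).
  move=> ch; apply: (@integrableS _ _ _ mu `[a, b]) => //.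
    exact: subset_itv_oc_cc.
  exact: continuous_integrable_segment.
apply: le_Rintegral => //; [exact: i|exact: i|move=> x /=].
by rewrite in_itv/= => /andP[ax xb]; rewrite fg// (ltW ax).
Qed.

Lemma tint_incr_norm f g h (a b : R) :
  continuous f -> continuous g -> continuous h ->
  0 <= a -> a <= b -> (forall s, a <= s <= b -> `|f s - g s| <= h s) ->
  `|(tint b f - tint a f) - (tint b g - tint a g)| <= tint b h - tint a h.
Proof.
move=> cf cg ch a0 ab fgh.
have cfg : continuous (fun s => f s - g s).
  by move=> x; apply: cvgB; [exact: cf|exact: cg].
have -> : (tint b f - tint a f) - (tint b g - tint a g) =
    tint b (fun s => f s - g s) - tint a (fun s => f s - g s).
  by rewrite !tintB//; ring.
have cnh : continuous (fun s => -1 * h s).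
  by move=> x; apply: cvgM; [exact: cvg_cst|exact: ch].
rewrite ler_norml; apply/andP; split; last first.
  by apply: tint_incr_le => // s /fgh; rewrite ler_norml => /andP[].
have -> : - (tint b h - tint a h) =
    tint b (fun s => -1 * h s) - tint a (fun s => -1 * h s).
  by rewrite !tintZ//; ring.
apply: tint_incr_le => // s /fgh; rewrite ler_norml => /andP[+ _].
by rewrite mulN1r.
Qed.

Lemma tint_norm f h (b : R) : continuous f -> continuous h ->
  0 <= b -> (forall s, 0 <= s <= b -> `|f s| <= h s) ->
  `|tint b f| <= tint b h.
Proof.
move=> cf ch b0 fh.
have c0 : continuous (fun _ : R => 0 : R) by move=> x; exact: cvg_cst.
have := @tint_incr_norm f (fun=> 0) h 0 b cf c0 ch (lexx _) b0.
rewrite tint_cst// !tint0 mul0r !subr0; apply => s /fh.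
by rewrite subr0.
Qed.

End tint.

(** * Partitions and Riemann sums *)

Section partitions.
Variable R : realType.
Implicit Types (s : seq R) (a b t : R).

Lemma partition_nth_le a b s j k : Defs.partition a b s -> (j <= k)%N ->
  (k < size s)%N -> nth 0 s j <= nth 0 s k.
Proof.
move=> [_ _ _ ss] jk ks.
have := @sorted_leq_nth _ (<=%R : rel R) le_trans lexx 0 s.
apply => //; first by apply: sub_sorted ss => x y; exact: ltW.
by rewrite inE (leq_ltn_trans jk).
Qed.

Lemma partition_nth_itv a b s k : Defs.partition a b s -> (k < size s)%N ->
  a <= nth 0 s k <= b.
Proof.
move=> ps ks; have [s0 <- <- _] := ps.
rewrite -nth0 -nth_last; apply/andP; split; apply: (partition_nth_le ps) => //.
  by rewrite -ltnS prednK.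
by rewrite prednK.
Qed.

Lemma partition_telescope (V : zmodType) (f : R -> V) a b s : Defs.partition a b s ->
  \sum_(k < (size s).-1) (f (nth 0 s k.+1) - f (nth 0 s k)) = f b - f a.
Proof.
move=> [s0 <- <- _]; rewrite -nth0 -nth_last.
rewrite -(big_mkord xpredT (fun k => f (nth 0 s k.+1) - f (nth 0 s k))).
by rewrite telescope_sumr.
Qed.

Lemma partition_mesh t del : 0 <= t -> 0 < del ->
  exists2 s, Defs.partition 0 t s &
    forall k, (k < (size s).-1)%N -> nth 0 s k.+1 - nth 0 s k < del.
Proof.
(* For t = 0 strict sortedness leaves only the one-point list; otherwise [0, t] is cut into n + 1
   equal cells. *)
move=> t0 del0; move: t0; rewrite le_eqVlt => /predU1P[<-|t0].
  by exists [:: 0].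
have [n] : exists n : nat, t / n.+1%:R < del.
  have := @near_infty_natSinv_lt R (PosNum (divr_gt0 del0 t0)).
  move=> [n _ /(_ n (leqnn _))] /=; rewrite ltr_pdivlMr// mulrC => h.
  by exists n.
move=> nd; pose f k : R := k%:R * (t / n.+1%:R).
have d0 : 0 < t / n.+1%:R by rewrite divr_gt0.
have fS k : f k.+1 - f k = t / n.+1%:R by rewrite /f -natr1 mulrDl mul1r addrAC subrr add0r.
exists (mkseq f n.+2).
  split; rewrite ?size_mkseq//.
  - by rewrite -nth0 nth_mkseq// /f mul0r.
  - by rewrite -nth_last size_mkseq nth_mkseq// /f mulrC divfK.
  - rewrite /mkseq; apply: (@homo_sorted _ _ f ltn); last exact: iota_ltn_sorted.
    by move=> i j ij; rewrite /f ltr_pM2r// ltr_nat.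
move=> k; rewrite size_mkseq => kn.
apply: le_lt_trans nd; rewrite -(fS k).
by rewrite !nth_mkseq// ltnS ltnW.
Qed.

(** [D k] is the integrand that replaces [p] on the cell k, typically with [H] frozen at a tag. The
    error on a cell is at most e times the integral of [N] over that cell, and these integrals
    telescope. *)
Lemma tint_partition_le (p N : R -> R) (D : nat -> R -> R) s t e :
  continuous p -> continuous N -> (forall k, continuous (D k)) ->
  Defs.partition 0 t s ->
  (forall k x, (k < (size s).-1)%N -> nth 0 s k <= x <= nth 0 s k.+1 ->
    `|p x - D k x| <= e * N x) ->
  `|tint t p - \sum_(k < (size s).-1)
      (tint (nth 0 s k.+1) (D k) - tint (nth 0 s k) (D k))| <= e * tint t N.
Proof.
move=> cp cN cD ps pDN.
have ceN : continuous (fun x => e * N x).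
  by move=> x; apply: cvgM; [exact: cvg_cst|exact: cN].
have <- := tintZ e t cN.
have tele f := partition_telescope (fun b => tint b f) ps.
have {}tele f : tint t f = \sum_(k < (size s).-1)
    (tint (nth 0 s k.+1) f - tint (nth 0 s k) f).
  by rewrite tele tint0 subr0.
rewrite (tele p) (tele (fun x => e * N x)).
rewrite -sumrB (le_trans (ler_norm_sum _ _ _))// ler_sum// => -[k ks] _ /=.
have ks' : (k.+1 < size s)%N by rewrite -ltn_predRL.
apply: tint_incr_norm => //.
- by have /andP[] := partition_nth_itv ps (ltnW ks').
- exact: (partition_nth_le ps).
- by move=> x; exact: pDN.
Qed.

(** This is [tint_partition_le] with [N] = 1 and [D k] the constant value of [f] at the left end of
    the cell. Dividing e by t + 1 rather than t covers t = 0. *)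
Lemma tint_riemann (f : R -> R) t e : continuous f -> 0 <= t -> 0 < e ->
  exists2 del : R, 0 < del & forall s, Defs.partition 0 t s ->
    (forall k, (k < (size s).-1)%N -> nth 0 s k.+1 - nth 0 s k < del) ->
    `|tint t f - \sum_(k < (size s).-1) f (nth 0 s k) * (nth 0 s k.+1 - nth 0 s k)| <= e.
Proof.
move=> cf t0 e0; have et0 : 0 < e / (t + 1) by rewrite divr_gt0// ltr_wpDl.
have cid : continuous (id : R -> R) by move=> x; exact: cvg_id.
have c1 (c : R) : continuous (fun _ : R => c) by move=> x; exact: cvg_cst.
have [del del0 hdel] := heine_segment 0 t cid cf et0.
exists del => // s ps ms.
have := @tint_partition_le f (fun=> 1) (fun k => (fun=> f (nth 0 s k))) s t (e / (t + 1))
  cf (c1 _) (fun=> c1 _) ps.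
have -> : \sum_(k < (size s).-1) (tint (nth 0 s k.+1) (fun=> f (nth 0 s k)) -
    tint (nth 0 s k) (fun=> f (nth 0 s k))) =
  \sum_(k < (size s).-1) f (nth 0 s k) * (nth 0 s k.+1 - nth 0 s k).
  apply: eq_bigr => -[k ks] _ /=.
  have ks' : (k.+1 < size s)%N by rewrite -ltn_predRL.
  have /andP[h1 _] := partition_nth_itv ps (ltnW ks').
  have /andP[h2 _] := partition_nth_itv ps ks'.
  by rewrite !tint_cst// mulrBr.
rewrite tint_cst// mul1r => h; apply: le_trans (h _) _; last first.
  by rewrite mulrAC ler_pdivrMr ?ltr_wpDl// ler_pM2l// lerDl.
move=> k x ks /andP[kx xk]; rewrite mulr1 ltW//.
have ks' : (k.+1 < size s)%N by rewrite -ltn_predRL.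
apply: (hdel _ (partition_nth_itv ps (ltnW ks'))).
by rewrite ger0_norm ?subr_ge0// (le_lt_trans _ (ms _ ks))// lerB.
Qed.

End partitions.

(** * Riemann-Stieltjes integrals: uniqueness and a Cauchy criterion *)

Section RS.
Variables (R : realType) (chi : normedModType R).
Variables (H : R -> chi) (Z : R -> chi -> R) (t : R).
Hypothesis t0 : 0 <= t.

Let fine_tagged (del : R) (s : seq R) (xi : nat -> R) :=
  Defs.partition 0 t s /\
  forall k, (k < (size s).-1)%N ->
    nth 0 s k.+1 - nth 0 s k < del /\ nth 0 s k <= xi k <= nth 0 s k.+1.

Let RSsum (s : seq R) (xi : nat -> R) :=
  \sum_(k < (size s).-1) (Z (nth 0 s k.+1) (H (xi k)) - Z (nth 0 s k) (H (xi k))).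

Let fine_tagged_exists (del : R) : 0 < del -> exists s xi, fine_tagged del s xi.
Proof.
move=> /(partition_mesh t0)[s ps ms]; exists s, (nth 0 s); split => // k ks.
split; first exact: ms.
by rewrite lexx/= (partition_nth_le ps)// -ltn_predRL.
Qed.

(** One sufficiently fine tagged sum is close to both values. Such a sum exists because 0 <= t; for
    negative t there is no partition and every number would qualify. *)
Lemma is_RS_integral_uniq I J :
  is_RS_integral H Z t I -> is_RS_integral H Z t J -> I = J.
Proof.
move=> hI hJ; apply/eqP; rewrite -subr_eq0 -normr_le0; apply/ler_addgt0Pr => e e0.
rewrite add0r; have e20 : 0 < e / 2 by rewrite divr_gt0.
have [d1 d10 h1] := hI _ e20.
have [d2 d20 h2] := hJ _ e20.
have d0 : 0 < Num.min d1 d2 by rewrite lt_min d10.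
have [s [xi [ps hs]]] := fine_tagged_exists d0.
have {}h1 : `|RSsum s xi - I| < e / 2.
  by apply: h1 => // k /hs[]; rewrite lt_min => /andP[].
have {}h2 : `|RSsum s xi - J| < e / 2.
  by apply: h2 => // k /hs[]; rewrite lt_min => /andP[].
rewrite distrC in h1.
rewrite (_ : I - J = (I - RSsum s xi) + (RSsum s xi - J)); last by rewrite subrKA.
by rewrite ltW// (le_lt_trans (ler_normD _ _))// (splitr e) ltrD.
Qed.

(** Closeness to a single fine sum already makes [y] a Cauchy sequence; its limit is then close to
    all fine sums. Limit and integral are thus obtained together. *)
Lemma is_RS_integral_lim (y : nat -> R) :
  (forall e : R, 0 < e -> exists2 del : R, 0 < del &
    forall s xi, Defs.partition 0 t s ->
      (forall k, (k < (size s).-1)%N ->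
        nth 0 s k.+1 - nth 0 s k < del /\ nth 0 s k <= xi k <= nth 0 s k.+1) ->
      \forall n \near \oo,
      `|y n - \sum_(k < (size s).-1)
          (Z (nth 0 s k.+1) (H (xi k)) - Z (nth 0 s k) (H (xi k)))| < e) ->
  exists2 I, y @ \oo --> I & is_RS_integral H Z t I.
Proof.
move=> hy.
have cy : cvgn y.
  apply/cauchy_cvgP/cauchyP => e e0.
  have [del del0 hdel] := hy _ e0.
  have [s [xi [ps hs]]] := fine_tagged_exists del0.
  exists (RSsum s xi); have := hdel _ _ ps hs.
  by apply: filterS => n; rewrite /ball/= distrC.
exists (limn y) => // e e0.
have e20 : 0 < e / 2 by rewrite divr_gt0.
have [del del0 hdel] := hy _ e20; exists del => // s xi ps hs.
have h1 := hdel _ _ ps hs.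
have /cvgrPdist_lt/(_ _ e20) h2 := cy.
near \oo => n.
have h1n : `|y n - RSsum s xi| < e / 2 by near: n.
have h2n : `|limn y - y n| < e / 2 by near: n.
rewrite distrC -/(RSsum s xi).
rewrite (_ : _ - _ = (limn y - y n) + (y n - RSsum s xi)); last by rewrite subrKA.
by rewrite (le_lt_trans (ler_normD _ _))// (splitr e) ltrD.
Unshelve. all: by end_near. Qed.

End RS.

(** * Passage to the limit along a single path *)

(* [D n s] stands for the regularized tensor increment at scale [eps n], [N n s]
   bounds its dual norm, and [p n s] is the regularized product of the real
   increments. *)
Section weak_limit.
Variables (R : realType) (chi : normedModType R) (T M : R).
Variables (p N : nat -> R -> R) (D : nat -> R -> chi -> R).
Variables (H : R -> chi) (Z : R -> chi -> R) (phi : nat -> chi).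
Hypotheses (T0 : 0 <= T) (cp : forall n, continuous (p n))
  (cN : forall n, continuous (N n))
  (cD : forall n f, continuous (fun s => D n s f)).
Hypotheses (N0 : forall n s, 0 <= N n s) (NM : forall n, tint T (N n) <= M).
Hypotheses (DB : forall n s f g, D n s (f - g) = D n s f - D n s g)
  (DN : forall n s f, `|D n s f| <= N n s * `|f|).
Hypothesis pD : forall e : R, 0 < e -> exists2 del : R, 0 < del &
  \forall n \near \oo, forall s u, 0 <= s <= T -> 0 <= u <= T ->
    `|s - u| < del -> `|p n s - D n s (H u)| <= e * N n s.
Hypotheses (ZB : forall t f g, Z t (f - g) = Z t f - Z t g)
  (Zbd : forall t, exists K : R, forall f, `|Z t f| <= K * `|f|).
Hypothesis dense : forall u, 0 <= u <= T -> forall e : R, 0 < e ->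
  exists m, `|H u - phi m| < e.
Hypothesis DZ : forall m t, 0 <= t <= T ->
  tint t (fun s => D n s (phi m)) @[n --> \oo] --> Z t (phi m).
Hypothesis Zc : forall m, {within `[0, T], continuous (fun t => Z t (phi m))}.

Let M0 : 0 <= M.
Proof.
apply: le_trans (NM 0); have c0 : continuous (fun _ : R => 0 : R) by move=> x; exact: cvg_cst.
have := @tint_incr_le R (fun=> 0) (N 0) 0 T c0 (@cN 0%N) (lexx _) T0 (fun s _ => N0 0 s).
by rewrite !tint_cst// !tint0 !mul0r !subr0.
Qed.

Let tintN_le n t : 0 <= t <= T -> tint t (N n) <= M.
Proof.
move=> /andP[t0 tT]; apply: le_trans (NM n).
have c0 : continuous (fun _ : R => 0 : R) by move=> x; exact: cvg_cst.
have := @tint_incr_le R (fun=> 0) (N n) t T c0 (@cN n) t0 tT (fun s _ => N0 n s).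
by rewrite !tint_cst// !mul0r subr0 subr_ge0.
Qed.

Let tintD_le n t f : 0 <= t <= T -> `|tint t (fun s => D n s f)| <= M * `|f|.
Proof.
move=> tT; have /andP[t0 _] := tT.
apply: le_trans (@tint_norm R _ (fun s => `|f| * N n s) t (@cD n f) _ t0 _) _.
- by move=> x; apply: cvgM; [exact: cvg_cst|exact: cN].
- by move=> s _; rewrite mulrC.
- by rewrite tintZ// mulrC ler_wpM2r// tintN_le.
Qed.

(** Both sides are Lipschitz in [f], the integrals with constant [M] for every n and [Z t] with
    constant [K], so convergence at the points [phi m] extends to their closure. *)
Let closure_cvg f t : (forall e : R, 0 < e -> exists m, `|f - phi m| < e) ->
  0 <= t <= T -> tint t (fun s => D n s f) @[n --> \oo] --> Z t f.
Proof.
move=> hf tT; have [K hK] := Zbd t.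
apply/cvgrPdist_lt => e e0.
have e20 : 0 < e / 2 by rewrite divr_gt0.
have K0 : 0 < M + `|K| + 1 by rewrite ltr_wpDl// addr_ge0.
have [m hm] := hf _ (divr_gt0 e20 K0).
have /cvgrPdist_lt/(_ _ e20) := @DZ m t tT.
apply: filterS => n hn.
rewrite (_ : Z t f - _ = (Z t (phi m) - tint t (fun s => D n s (phi m))) +
   (Z t (f - phi m) - tint t (fun s => D n s (f - phi m)))); last first.
  rewrite ZB (_ : (fun s => D n s (f - phi m)) = (fun s => D n s f - D n s (phi m))).
    by rewrite tintB//; ring.
  by apply/funext => s; rewrite DB.
rewrite (le_lt_trans (ler_normD _ _))// (splitr e) ltr_leD//.
rewrite (le_trans (ler_normB _ _))//.
apply: (@le_trans _ _ ((M + `|K| + 1) * `|f - phi m|)).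
  rewrite addrAC mulrDl [leRHS]addrC lerD//; last first.
    rewrite (le_trans (tintD_le _ _ tT))// ler_wpM2r// lerDl//.
  by rewrite (le_trans (hK _))// ler_wpM2r// ler_norm.
by move: hm; rewrite ltr_pdivlMr// mulrC => /ltW.
Qed.

Let H_cvg u t : 0 <= u <= T -> 0 <= t <= T ->
  tint t (fun s => D n s (H u)) @[n --> \oo] --> Z t (H u).
Proof. by move=> uT; apply: closure_cvg => e; exact: dense. Qed.

(** A tagged sum of [Z] is the limit of the sums of integrals of [D n] with [H] frozen at the tags.
    By [tint_partition_le] these stay within e / 2 of the integral of [p n], the factor 1 / (M + 1)
    absorbing the mass of [N n]. *)
Let RS_cvg t : 0 <= t <= T ->
  exists2 I, (fun n => tint t (p n)) @ \oo --> I & is_RS_integral H Z t I.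
Proof.
move=> tT; have /andP[t0 tT'] := tT; apply: is_RS_integral_lim => // e e0.
have e20 : 0 < e / 2 by rewrite divr_gt0.
have M1 : 0 < M + 1 by rewrite ltr_wpDl.
have [del del0 hdel] := pD (divr_gt0 e20 M1).
exists del => // s xi ps hs.
have ks' k : (k < (size s).-1)%N -> (k.+1 < size s)%N by rewrite -ltn_predRL.
have inT k : (k < size s)%N -> 0 <= nth 0 s k <= T.
  by move=> /(partition_nth_itv ps)/andP[-> h]; rewrite (le_trans h).
have xiT k : (k < (size s).-1)%N -> 0 <= xi k <= T.
  move=> ks; have [_ /andP[h1 h2]] := hs _ ks.
  have /andP[g1 _] := inT _ (ltnW (ks' _ ks)).
  have /andP[_ g2] := inT _ (ks' _ ks).
  by rewrite (le_trans g1)// (le_trans h2).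
have hsum : \sum_(k < (size s).-1)
      (tint (nth 0 s k.+1) (fun x => D n x (H (xi k)))
       - tint (nth 0 s k) (fun x => D n x (H (xi k)))) @[n --> \oo] -->
   \sum_(k < (size s).-1) (Z (nth 0 s k.+1) (H (xi k)) - Z (nth 0 s k) (H (xi k))).
  apply: cvg_big => [|[k ks] _ /=]; first exact: add_continuous.
  apply: cvgB; apply: H_cvg; [exact: xiT|exact: inT (ks' _ ks)|exact: xiT|].
  exact: inT (ltnW (ks' _ ks)).
have /cvgrPdist_lt/(_ _ e20) := hsum.
apply: filterS2 hdel => n hn hsn.
have := @tint_partition_le R (p n) (N n) (fun k x => D n x (H (xi k))) s t
  (e / 2 / (M + 1)) (@cp n) (@cN n) (fun k => @cD n _) ps.
set S := (X in `|_ - X| <= _) => hS.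
set S' := (X in `|_ - X| < _).
rewrite (_ : _ - S' = (tint t (p n) - S) - (S' - S)); last by ring.
rewrite (le_lt_trans (ler_normB _ _))// (splitr e) ler_ltD//.
apply: le_trans (hS _) _.
  move=> k x ks /andP[kx xk]; apply: hn; last 1 first.
  - have [h1 /andP[h2 h3]] := hs _ ks; rewrite ltr_norml; apply/andP; split; lra.
  - have /andP[g1 _] := inT _ (ltnW (ks' _ ks)).
    have /andP[_ g2] := inT _ (ks' _ ks).
    by rewrite (le_trans g1)// (le_trans xk).
  - exact: xiT.
rewrite mulrAC ler_pdivrMr// ler_pM2l// (le_trans (tintN_le _ tT))//.
by rewrite lerDl.
Qed.

Let q t := lim (tint t (p n) @[n --> \oo]).

(** The freezing estimate on one short cell, passed to the limit in n. It reduces continuity of [q]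
    to that of [Z] tested against a fixed value of [H]. *)
Let q_incr e : 0 < e -> exists2 del : R, 0 < del &
  forall a b u, 0 <= a -> a <= b -> b <= T -> a <= u <= b -> b - a < del ->
    `|(q b - q a) - (Z b (H u) - Z a (H u))| <= e.
Proof.
move=> e0; have M1 : 0 < M + 1 by rewrite ltr_wpDl.
have [del del0 hdel] := pD (divr_gt0 e0 M1).
exists del => // a b u a0 ab bT /andP[au ub] abd.
have aT : 0 <= a <= T by rewrite a0 (le_trans ab).
have bT' : 0 <= b <= T by rewrite (le_trans a0 ab).
have uT : 0 <= u <= T by rewrite (le_trans a0 au) (le_trans ub).
have cq t : 0 <= t <= T -> tint t (p n) @[n --> \oo] --> q t.
  by move=> /RS_cvg[I hI _]; apply/cvg_ex; exists I.
have hc : `|(tint b (p n) - tint a (p n)) -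
     (tint b (fun s => D n s (H u)) - tint a (fun s => D n s (H u)))| @[n --> \oo]
     --> `|(q b - q a) - (Z b (H u) - Z a (H u))|.
  apply: cvg_norm; apply: cvgB; apply: cvgB; [exact: cq|exact: cq|exact: H_cvg|exact: H_cvg].
apply: (ler_cvg_to hc (cvg_cst e)).
apply: filterS hdel => n hn.
have ceN : continuous (fun s => e / (M + 1) * N n s).
  by move=> x; apply: cvgM; [exact: cvg_cst|exact: cN].
apply: le_trans (@tint_incr_norm R _ _ (fun s => e / (M + 1) * N n s) a b
   (@cp n) (@cD n _) ceN a0 ab _) _.
  move=> s /andP[as_ sb]; apply: hn => //.
    by rewrite (le_trans a0 as_) (le_trans sb).
  by rewrite ltr_norml; apply/andP; split; lra.
rewrite !tintZ// -mulrBr mulrAC ler_pdivrMr// ler_pM2l//.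
have c0 : continuous (fun _ : R => 0 : R) by move=> x; exact: cvg_cst.
have := @tint_incr_le R (fun=> 0) (N n) 0 a c0 (@cN n) (lexx _) a0 (fun s _ => N0 n s).
rewrite !tint_cst// !tint0 !mul0r !subr0 => h.
by have := tintN_le n bT'; lra.
Qed.

(** The constant in [Zbd] may vary with t. Passing to the limit in the bound on the integrals gives
    the constant [M] for all times at once. *)
Let Z_lip t u m : 0 <= u <= T -> 0 <= t <= T ->
  `|Z t (H u) - Z t (phi m)| <= M * `|H u - phi m|.
Proof.
move=> uT tT.
have hc : `|tint t (fun s => D n s (H u)) - tint t (fun s => D n s (phi m))|
    @[n --> \oo] --> `|Z t (H u) - Z t (phi m)|.
  by apply: cvg_norm; apply: cvgB; [exact: H_cvg|exact: DZ].
apply: (ler_cvg_to hc (cvg_cst (M * `|H u - phi m|))).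
apply: nearW => n; rewrite -tintB//.
rewrite (_ : (fun s => _) = (fun s => D n s (H u - phi m))); first exact: tintD_le.
by apply/funext => s; rewrite DB.
Qed.

(** Used with [a], [b] the values of [q] at t and r, [c], [d] those of [Z] against [H t], and [x],
    [y] those of [Z] against a nearby [phi m]. *)
Let quarters (a b c d x y e : R) : `|(a - b) - (c - d)| <= e / 4 ->
  `|d - y| <= e / 4 -> `|c - x| <= e / 4 -> `|x - y| <= e / 4 -> `|a - b| <= e.
Proof.
rewrite !ler_norml => /andP[? ?] /andP[? ?] /andP[? ?] /andP[? ?].
by apply/andP; split; lra.
Qed.

(** [Zc] gives continuity in time only against the [phi m]; [Z_lip] transfers it to [H t], up to an
    error uniform in time, and [q_incr] to [q]. *)
Let q_continuous : {within `[0, T], continuous q}.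
Proof.
apply/subspace_continuousP => t /=; rewrite in_itv/= => tT.
have /andP[t0 tT'] := tT.
apply/cvgrPdist_le => e e0.
have e40 : 0 < e / 4 by rewrite divr_gt0.
have M1 : 0 < M + 1 by rewrite ltr_wpDl.
have [del del0 hdel] := q_incr e40.
have [m hm] := dense tT (divr_gt0 e40 M1).
have /subspace_continuousP/(_ t) := @Zc m.
rewrite /= in_itv/= => /(_ tT)/cvgrPdist_lt/(_ _ e40) hz.
have hM : M * `|H t - phi m| <= e / 4.
  move: hm; rewrite ltr_pdivlMr// mulrC => /ltW; apply: le_trans.
  by rewrite ler_wpM2r// lerDl.
have ntd : \forall r \near within `[0, T] (nbhs t), `|t - r| < del.
  have /cvgrPdist_lt/(_ _ del0) hid : (id : R -> R) @ t --> t by exact: cvg_id.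
  by rewrite near_withinE; apply: filterS hid => r h _.
near=> r.
have rT : 0 <= r <= T.
  have : `[0, T]%classic r by near: r; exact: withinT.
  by rewrite /= in_itv.
have /andP[r0 rT'] := rT.
have hzr : `|Z t (phi m) - Z r (phi m)| < e / 4 by near: r.
have tr : `|t - r| < del by near: r; exact: ntd.
have h1 := le_trans (@Z_lip r t m tT rT) hM.
have h2 := le_trans (@Z_lip t t m tT tT) hM.
have h3 : `|(q t - q r) - (Z t (H t) - Z r (H t))| <= e / 4.
  have [rt|/ltW tr'] := leP r t.
    apply: hdel => //; first by rewrite rt lexx.
    by move: tr; rewrite ger0_norm// subr_ge0.
  have -> : (q t - q r) - (Z t (H t) - Z r (H t)) =
      - ((q r - q t) - (Z r (H t) - Z t (H t))) by ring.
  rewrite normrN.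
  apply: hdel => //; first by rewrite tr' lexx.
  by move: tr; rewrite distrC ger0_norm// subr_ge0.
exact: (quarters h3 h1 h2 (ltW hzr)).
Unshelve. all: by end_near. Qed.

Lemma stieltjes_of_weak_limit : exists q : R -> R,
  [/\ {within `[0, T], continuous q},
      (forall t, 0 <= t <= T -> tint t (p n) @[n --> \oo] --> q t) &
      (forall t, 0 <= t <= T -> is_RS_integral H Z t (q t))].
Proof.
exists q; split => // t /RS_cvg[I hI hRS].
  by apply/cvg_ex; exists I.
by rewrite /q (cvg_lim _ hI).
Qed.

End weak_limit.

(** * Convergence in probability and almost sure convergence along subsequences *)

Lemma ae_forall_countable (R : realType) (d : measure_display) (U : measurableType d)
    (mu : {measure set U -> \bar R}) (I : countType) (Q : I -> U -> Prop) :
  (forall i, {ae mu, forall x, Q i x}) -> {ae mu, forall x, forall i, Q i x}.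
Proof.
move=> h; have : \forall x \ae mu, forall n : nat,
    if (unpickle n : option I) is Some i then Q i x else True.
  apply/ae_foralln => n; case: unpickle => [i|]; first exact: h.
  exact: nearW.
by apply: filterS => x hx i; have := hx (pickle i); rewrite pickleK.
Qed.

Section convergence_in_probability.
Variables (R : realType) (d : measure_display) (Omega : measurableType d).
Variable P : probability Omega R.

(* Measurability is needed here: an almost sure limit of nonmeasurable functions
   need not be a limit in outer probability. *)
Lemma cvg_prob0_subseq (Y : R -> Omega -> R) (L : Omega -> R) :
  (forall eps, 0 < eps -> measurable_fun setT (Y eps)) ->
  (forall eps : nat -> R, (forall n, 0 < eps n) -> eps @ \oo --> (0 : R) ->
    exists sig : nat -> nat,
      {ae P, forall w, Y (eps (sig k)) w @[k --> \oo] --> L w}) ->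
  cvg_prob0 P Y L.
Proof.
move=> mY hY delta eta delta0 eta0; apply: contrapT => hn.
(* If the convergence failed, there would be a bad scale below each 1 / (n + 1), hence a sequence of
   bad scales tending to 0. *)
have {}hn n : exists eps : R, [/\ 0 < eps, eps < n.+1%:R^-1 &
    ~ outP_le P [set w | delta < `|Y eps w - L w|] eta].
  apply: contrapT => hne; apply: hn; exists n.+1%:R^-1; first by rewrite invr_gt0.
  move=> eps eps0 epsn; apply: contrapT => ho; apply: hne.
  by exists eps.
have [eps heps] := choice hn.
have eps0 n : 0 < eps n by have [] := heps n.
have ceps : eps @ \oo --> (0 : R).
  apply/cvgrPdist_lt => e e0; have := near_infty_natSinv_lt (PosNum e0).
  apply: filterS => n /= hne; have [h1 h2 _] := heps n.
  by rewrite sub0r normrN gtr0_norm// (lt_trans h2).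
have [sig [A [mA A0 hA]]] := hY _ eps0 ceps.
(* Egorov's theorem: off the null set [A] and a set [B] of probability below eta the convergence is
   uniform, so at some bad scale the deviation set lies in the union of [A] and [B], a
   contradiction. *)
have [||||B [mB PB uB]] := @pointwise_almost_uniform d R Omega P
  (fun k => Y (eps (sig k))) L (~` A) eta _ _ _ _ eta0.
- by move=> n; apply: measurable_funTS; exact: mY.
- exact: measurableC.
- by rewrite (le_lt_trans (probability_le1 _ _))// ?ltry//; exact: measurableC.
- by move=> w nAw; apply: contrapT => hw; apply: nAw; exact: hA.
have /uB [n0 _ hn0] : nbhs (L : {uniform` (~` A) `\` B -> R})
    [set h | forall w, ((~` A) `\` B) w -> `|L w - h w| < delta].
  apply/uniform_nbhs; exists [set xy | ball xy.1 delta xy.2].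
  by split=> //; rewrite -entourage_ballE; exists delta.
have [_ _] := heps (sig n0); apply; exists (A `|` B); first exact: measurableU.
split; last first.
  apply: le_trans (measureU2 _ mA mB) _; rewrite -[leRHS]add0e.
  by apply: leeD; [move: A0 => /= ->|exact: ltW].
move=> w /=; apply: contraPP => /not_orP[nAw nBw]; apply/negP.
rewrite -leNgt distrC ltW//.
by apply: (hn0 n0 (leqnn _)).
Qed.

(** Borel-Cantelli: the probabilities sum to at most 1, so the upper limit of the sets is null. *)
Let tail_avoid (M : nat -> set Omega) :
  (forall k, measurable (M k)) ->
  (forall k, (P (M k) <= (1 / (2 ^ k.+1)%:R)%:E)%E) ->
  {ae P, forall w, \forall k \near \oo, ~ M k w}.
Proof.
move=> mM PM; exists (lim_sup_set M); split.
- by apply: bigcap_measurable => // n _; apply: bigcup_measurable => k _.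
- apply: lim_sup_set_cvg0 => //; apply: (@le_lt_trans _ _ 1%:E); last exact: ltry.
  apply: le_trans (epsilon_trick0 xpredT (@ler01 R)).
  by apply: lee_nneseries => k _ //; exact: PM.
- move=> w hw n _; apply: contrapT => h; apply: hw.
  by exists n => // j nj Mjw; apply: h; exists j.
Qed.

(** A diagonal choice: at stage k only the indices below k are controlled, with precision 1 / (k +
    1) and off a set of probability at most 2^-(k+1). Each m is controlled from stage m + 1 on, so
    one subsequence serves all m and t. *)
Lemma ucp0_ae_subseq (T : R) (Y : nat -> R -> Omega -> R -> R)
    (C : nat -> Omega -> R -> R) (eps : nat -> R) :
  (forall m, ucp0 P T (Y m) (C m)) ->
  (forall n, 0 < eps n) -> eps @ \oo --> (0 : R) ->
  exists2 sig : nat -> nat, (forall k, (k <= sig k)%N) &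
    {ae P, forall w, forall m t, 0 <= t <= T ->
      Y m (eps (sig k)) w t @[k --> \oo] --> C m w t}.
Proof.
move=> hY eps0 ceps.
have fin_unif n (delta eta : R) : 0 < delta -> 0 < eta ->
    exists2 e0 : R, 0 < e0 & forall e, 0 < e -> e < e0 ->
    exists M, [/\ measurable M, (P M <= (n%:R * eta)%:E)%E &
      forall w, ~ M w -> forall m t, (m < n)%N -> 0 <= t <= T ->
        `|Y m e w t - C m w t| <= delta].
  move=> delta0 eta0; elim: n => [|n [e1 e10 h1]].
    by exists 1 => // e _ _; exists set0; split => //; rewrite measure0 mul0r.
  have [e2 e20 h2] := hY n _ _ delta0 eta0.
  exists (Num.min e1 e2); first by rewrite lt_min e10.
  move=> e e0; rewrite lt_min => /andP[ee1 ee2].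
  have [M1 [mM1 PM1 hM1]] := h1 _ e0 ee1.
  have [M2 mM2 [hM2 PM2]] := h2 _ e0 ee2.
  exists (M1 `|` M2); split; first exact: measurableU.
    rewrite (le_trans (measureU2 _ _ _))// -natr1 mulrDl mul1r EFinD.
    exact: leeD.
  move=> w /not_orP[nM1 nM2] m t; rewrite ltnS leq_eqVlt => /predU1P[->|mn] tT.
    rewrite leNgt; apply/negP => hlt; apply: nM2; apply: hM2.
    by exists t.
  exact: hM1.
have hk k : exists Nk : nat, forall n, (Nk <= n)%N ->
    exists M, [/\ measurable M, (P M <= (1 / (2 ^ k.+1)%:R)%:E)%E &
      forall w, ~ M w -> forall m t, (m < k)%N -> 0 <= t <= T ->
        `|Y m (eps n) w t - C m w t| <= k.+1%:R^-1].
  (* The union over k indices costs k times eta, and k / (k + 1) is at most 1. *)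
  have eta0 : (0 : R) < 1 / (2 ^ k.+1)%:R / k.+1%:R.
    by rewrite !divr_gt0// ltr0n expn_gt0.
  have k0 : (0 : R) < k.+1%:R^-1 by rewrite invr_gt0.
  have [e0 e00 he0] := fin_unif k _ _ k0 eta0.
  have /cvgrPdist_lt/(_ _ e00)[Nk _ hNk] := ceps.
  exists Nk => n /hNk /=; rewrite sub0r normrN gtr0_norm// => /(he0 _ (eps0 n)).
  move=> [M [mM PM hM]]; exists M; split => //.
  apply: (le_trans PM); rewrite lee_fin mulrCA ler_piMr//.
  by rewrite ler_pdivrMr// mul1r ler_nat.
have [Nf hNf] := choice hk.
(* The maximum with k makes [sig] tend to infinity; monotonicity is not asked for. *)
pose sig k := maxn k (Nf k).
have hs k : (Nf k <= sig k)%N by rewrite leq_maxr.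
have [M hM] := choice (fun k => hNf k _ (hs k)).
exists sig; first by move=> k; rewrite leq_maxl.
have : {ae P, forall w, \forall k \near \oo, ~ M k w}.
  by apply: tail_avoid => k; have [] := hM k.
apply: filterS => w hw m t tT; apply/cvgrPdist_lt => e e0.
have hm : \forall k \near \oo, (m < k)%N by exists m.+1.
have := near_infty_natSinv_lt (PosNum e0).
apply: filterS3 hw hm => k nM mk /= ke.
have [_ _ h] := hM k.
by rewrite distrC (le_lt_trans (h _ nM _ _ mk tT)).
Qed.

End convergence_in_probability.

(** * Paths extended by constants outside [0, T] *)

Section paths.
Variables (R : realType) (T : R).
Hypothesis T0 : 0 <= T.

Lemma clip_itv (t : R) : 0 <= Num.min T (Num.max 0 t) <= T.
Proof. by rewrite le_min T0 le_max lexx ge_min lexx. Qed.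

Lemma clip_id (t : R) : 0 <= t <= T -> Num.min T (Num.max 0 t) = t.
Proof. by move=> /andP[t0 tT]; rewrite max_r// min_r. Qed.

Lemma extT_id (V : Type) (f : R -> V) t : 0 <= t <= T -> extT T f t = f t.
Proof. by move=> tT; rewrite /extT clip_id. Qed.

(** The extension is [f] composed with the continuous retraction of the line onto [0, T]. *)
Lemma extT_continuous (V : topologicalType) (f : R -> V) :
  {within `[0, T], continuous f} -> continuous (extT T f).
Proof.
move=> /subspace_continuousP cf t.
have cclip : continuous (fun s : R => Num.min T (Num.max 0 s)).
  move=> s; apply: (@continuous_min R R (fun=> T) (fun s => Num.max 0 s)).
    exact: cvg_cst.
  apply: (@continuous_max R R (fun=> 0) (fun s => s)); first exact: cvg_cst.
  exact: cvg_id.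
have := cf (Num.min T (Num.max 0 t)); rewrite /= in_itv/= clip_itv => /(_ isT) ct.
move=> A /ct hA; change (nbhs t (extT T f @^-1` A)).
have hB : nbhs t ((fun s : R => Num.min T (Num.max 0 s)) @^-1`
    [set r | `[0, T]%classic r -> A (f r)]) by exact: (cclip t).
by apply: filterS hB => s; apply; rewrite /= in_itv/= clip_itv.
Qed.

Lemma extT_shift_continuous (V : topologicalType) (f : R -> V) (e : R) :
  {within `[0, T], continuous f} -> continuous (fun s => extT T f (s + e)).
Proof.
move=> /extT_continuous cf t.
apply: (@continuous_comp _ _ _ (fun s : R => s + e)); last exact: cf.
by apply: cvgD; [exact: cvg_id|exact: cvg_cst].
Qed.

Lemma extT_increment_continuous (V : normedModType R) (f : R -> V) (e : R) :
  {within `[0, T], continuous f} ->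
  continuous (fun s => extT T f (s + e) - extT T f s).
Proof.
move=> cf t; apply: cvgB; first exact: extT_shift_continuous.
exact: extT_continuous.
Qed.

End paths.

(** * A continuity criterion and the mean value theorem *)

(** [h] may depend on the base point t; it will be a bilinear estimate in the increments from t. *)
Lemma continuous_at_dominated (R : realType) (g h : R -> R) (t : R) :
  {for t, continuous h} -> h t = 0 -> (forall s, `|g s - g t| <= h s) ->
  {for t, continuous g}.
Proof.
move=> ch h0 gh; apply/cvgrPdist_lt => e e0.
have /cvgrPdist_lt/(_ _ e0) := ch; apply: filterS => s.
rewrite h0 sub0r normrN => hs; rewrite distrC.
by rewrite (le_lt_trans (gh s))// (le_lt_trans (ler_norm _)).
Qed.

(** The one-variable mean value theorem applied to [F] on the segment from x to y. Only the distance
    from [c] to x is retained, which is what uniform continuity along the path consumes. *)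
Lemma frechet_mean_value (R : realType) (B : normedModType R) (F : B -> R)
    (x y : B) : (forall z, differentiable F z) ->
  exists2 c, `|c - x| <= `|y - x| & F y - F x = 'd F c (y - x).
Proof.
move=> dF; pose g (r : R) : B := x + r *: (y - x).
have dg r : is_diff r g (fun h => h *: (y - x)).
  by apply: is_diff_eq; apply/funext => h /=; rewrite add0r.
have dgr (r : R) : differentiable g r by have := dg r; case.
have dFgr (r : R) : differentiable (F \o g) r by exact: differentiable_comp.
have dFg (r : R) : r \in `]0, 1[ -> is_derive r 1 (F \o g) ('d F (g r) (y - x)).
  move=> _; have h : derivable (F \o g) r 1 := diff_derivable (dFgr r).
  apply: (DeriveDef h); rewrite deriveE// (diff_comp (dgr r) (dF _)).
  by rewrite /= (@diff_val _ _ _ _ _ _ _ (dg r)) scale1r.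
have [|c + ] := MVT_segment ler01 dFg.
  apply: continuous_subspaceT => r; exact: differentiable_continuous.
rewrite in_itv/= => /andP[c0 c1].
rewrite /g /= scale1r scale0r addr0 subr0 mulr1 [x + (y - x)]addrC subrK.
move=> h; exists (x + c *: (y - x)) => //.
by rewrite addrAC subrr add0r normrZ ger0_norm// ler_piMl.
Qed.

(** * The dual of [chi] and its norm *)

Section dual_norm.
Variables (R : realType) (chi : normedModType R).
Implicit Types (z : chi -> R) (f : chi).

Lemma chi_dual0 z : in_chi_dual z -> z 0 = 0.
Proof.
move=> [lz _]; have := lz 1 0 0; rewrite scale1r addr0 mul1r => /eqP.
by rewrite -subr_eq subrr eq_sym => /eqP.
Qed.

Lemma chi_dualZ z (k : R) f : in_chi_dual z -> z (k *: f) = k * z f.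
Proof.
by move=> hz; have [lz _] := hz; rewrite -[k *: f]addr0 lz chi_dual0// addr0.
Qed.

Lemma chi_dualB z f g : in_chi_dual z -> z (f - g) = z f - z g.
Proof. by move=> [lz _]; rewrite addrC -scaleN1r lz mulN1r addrC. Qed.

Lemma chi_dual_sub z z' : in_chi_dual z -> in_chi_dual z' -> in_chi_dual (dsub z z').
Proof.
move=> [lz [M hM]] [lz' [M' hM']]; split.
  by move=> k f g; rewrite /dsub lz lz'; ring.
exists (M + M') => f; rewrite mulrDl /dsub (le_trans (ler_normB _ _))//.
exact: lerD.
Qed.

Lemma dual_norm_le z K : (forall f, `|f| <= 1 -> `|z f| <= K) -> dnorm z <= K.
Proof.
move=> h; apply: ge_sup; first by exists `|z 0|; exists 0 => //=; rewrite normr0.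
by move=> _ [f /= f1 <-]; exact: h.
Qed.

Lemma dual_norm_ub z f : in_chi_dual z -> `|f| <= 1 -> `|z f| <= dnorm z.
Proof.
move=> [_ [M hM]] f1; apply: ub_le_sup; last by exists f.
exists `|M| => _ [g /= g1 <-]; rewrite (le_trans (hM g))//.
by rewrite (le_trans (ler_norm _))// normrM normr_id ler_piMr.
Qed.

Lemma dual_norm_ge0 z : in_chi_dual z -> 0 <= dnorm z.
Proof.
by move=> hz; apply: le_trans (dual_norm_ub hz (_ : `|0| <= 1)); rewrite ?normr0.
Qed.

Lemma dual_normP z f : in_chi_dual z -> `|z f| <= dnorm z * `|f|.
Proof.
move=> hz; have [->|f0] := eqVneq f 0; first by rewrite chi_dual0// !normr0 mulr0.
have nf0 : 0 < `|f| by rewrite normr_gt0.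
have h : `|(`|f|^-1 *: f)| <= 1.
  by rewrite normrZ normfV normr_id mulVf ?gt_eqF.
have := dual_norm_ub hz h.
by rewrite chi_dualZ// normrM normfV normr_id mulrC ler_pdivrMr.
Qed.

Lemma dual_norm_dist z z' K : in_chi_dual z -> in_chi_dual z' ->
  (forall f, `|f| <= 1 -> `|z f - z' f| <= K) -> `|dnorm z - dnorm z'| <= K.
Proof.
move=> hz hz' h; rewrite ler_distl lerBlDr; apply/andP; split; apply: dual_norm_le => f f1.
  have -> : z' f = z f - (z f - z' f) by ring.
  by rewrite (le_trans (ler_normB _ _))// lerD ?dual_norm_ub ?h.
have -> : z f = z' f + (z f - z' f) by ring.
by rewrite (le_trans (ler_normD _ _))// lerD ?dual_norm_ub ?h.
Qed.

End dual_norm.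

(** * Tensors of increments as elements of the dual of [chi] *)

Section tensor.
Variables (R : realType) (B chi : normedModType R) (iota : chi -> B -> B -> R).
Hypothesis hchi : chi_subspace iota.

Lemma tens_chi_dual a c : in_chi_dual (tens iota a c).
Proof.
have [_ [lin [_ [M hM]]]] := hchi; split; first by move=> *; exact: lin.
exists (M * `|a| * `|c|) => f.
have -> : M * `|a| * `|c| * `|f| = M * `|f| * `|a| * `|c| by ring.
exact: hM.
Qed.

(** Change one argument at a time by bilinearity. The constant depends on [f] only through its norm,
    so the estimate serves both a fixed [f] and the supremum over the unit ball. *)
Lemma iota_path_dist : exists2 M : R, 0 <= M &
  forall f a c a' c', `|iota f a c - iota f a' c'| <=
    M * `|f| * (`|a - a'| * `|c| + `|a'| * `|c - c'|).
Proof.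
have [bil [_ [_ [M hM]]]] := hchi; exists `|M| => // f a c a' c'.
have [l [r _]] := bil f.
have -> : iota f a c - iota f a' c' = iota f (a - a') c + iota f a' (c - c').
  by rewrite [a - a']addrC -(scaleN1r a') l [c - c']addrC -(scaleN1r c') r; ring.
have hM' b e : `|iota f b e| <= `|M| * `|f| * (`|b| * `|e|).
  rewrite (le_trans (hM f b e))// -!mulrA ler_wpM2r// ?ler_norm//.
by rewrite mulrDr (le_trans (ler_normD _ _))// lerD.
Qed.

Section path.
Variables x y : R -> B.
Hypotheses (cx : continuous x) (cy : continuous y).

Let cbound (K : R) (t : R) :
  {for t, continuous (fun s => K * (`|x s - x t| * `|y s| + `|x t| * `|y s - y t|))}.
Proof.
apply: cvgM; first exact: cvg_cst.
apply: cvgD; apply: cvgM; try exact: cvg_cst.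
- by apply: cvg_norm; apply: cvgB; [exact: cx|exact: cvg_cst].
- by apply: cvg_norm; exact: cy.
- by apply: cvg_norm; apply: cvgB; [exact: cy|exact: cvg_cst].
Qed.

Lemma iota_path_continuous f : continuous (fun s => iota f (x s) (y s)).
Proof.
have [M M0 hM] := iota_path_dist => t.
refine (continuous_at_dominated (@cbound (M * `|f|) t) _ (fun s => hM _ _ _ _ _)).
by rewrite !subrr !normr0 mul0r mulr0 addr0 mulr0.
Qed.

(** The modulus of continuity is common to the whole unit ball, hence survives the supremum. This
    makes the integrand of (H1) continuous, so integrable. *)
Lemma dnorm_path_continuous : continuous (fun s => dnorm (tens iota (x s) (y s))).
Proof.
have [M M0 hM] := iota_path_dist => t.
apply: (continuous_at_dominated (@cbound M t)) => [|s].
  by rewrite !subrr !normr0 mul0r mulr0 addr0 mulr0.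
apply: dual_norm_dist; [exact: tens_chi_dual|exact: tens_chi_dual|move=> f f1].
apply: le_trans (hM _ _ _ _ _) _; apply: ler_wpM2r; last by rewrite ler_piMr.
by rewrite addr_ge0// mulr_ge0.
Qed.

End path.
End tensor.

(** * Measurability of integrals, and from rational times to all times *)

(** The integral is a pointwise limit of Riemann sums over partitions that do not depend on w, so
    measurability at each fixed time suffices. *)
Lemma measurable_tint (R : realType) (d : measure_display) (Omega : measurableType d)
    (f : Omega -> R -> R) (t : R) : 0 <= t ->
  (forall w, continuous (f w)) -> (forall s, measurable_fun setT (f ^~ s)) ->
  measurable_fun setT (fun w => tint t (f w)).
Proof.
move=> t0 cf mf.
have hp (n : nat) : exists s, Defs.partition 0 t s /\
    forall k, (k < (size s).-1)%N -> nth 0 s k.+1 - nth 0 s k < n.+1%:R^-1.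
  have n0 : (0 : R) < n.+1%:R^-1 by rewrite invr_gt0.
  by have [s ps ms] := partition_mesh t0 n0; exists s.
have [s hs] := choice hp.
pose h n w := \sum_(k < (size (s n)).-1)
  f w (nth 0 (s n) k) * (nth 0 (s n) k.+1 - nth 0 (s n) k).
apply: (@measurable_fun_cvg _ _ _ _ h).
  move=> n; apply: measurable_sum => k; apply: measurable_funM => //.
move=> w _; apply/cvgrPdist_le => e e0.
have [del del0 hdel] := tint_riemann (cf w) t0 e0.
have := near_infty_natSinv_lt (PosNum del0).
apply: filterS => n /= hn; have [ps ms] := hs n.
by apply: hdel => // k /ms kn; exact: lt_trans hn.
Qed.

(** (H2) identifies [Z] with a continuous process almost surely at each fixed time. Countably many
    rational times share one null set, and right continuity does the rest. *)
Lemma cadlag_eq_continuous (R : realType) (chi : normedModType R) (T : R)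
    (Z : R -> chi -> R) (f : chi) (c : R -> R) : 0 < T ->
  (forall t, in_chi_dual (Z t)) -> dual_cadlag T Z ->
  {within `[0, T], continuous c} ->
  (forall r : rat, Z (Num.min T (Num.max 0 (ratr r))) f =
                   c (Num.min T (Num.max 0 (ratr r)))) ->
  forall t, 0 <= t <= T -> Z t f = c t.
Proof.
move=> T0 dZ [rZ _] cc hr t tT.
have hr' u (r : rat) : ratr r = u -> 0 <= u <= T -> Z u f = c u.
  by move=> <- uT; have := hr r; rewrite clip_id.
have /andP[t0] := tT; rewrite le_eqVlt => /predU1P[->|tltT].
  (* At t = T there is no room on the right, but a rational above T is clipped to T, so T is itself
     a tested time. *)
  have TT1 : T < T + 1 by rewrite ltrDl.
  have [r] := rat_in_itvoo TT1; rewrite in_itv/= => /andP[Tr _].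
  have := hr r; rewrite max_r ?min_l//; first exact: ltW.
  exact: ltW (lt_trans T0 Tr).
apply/eqP; rewrite -subr_eq0 -normr_le0; apply/ler_addgt0Pr => e e0; rewrite add0r.
have e20 : 0 < e / 2 by rewrite divr_gt0.
have f0 : 0 < `|f| + 1 by rewrite ltr_wpDl.
have [|d1 d10 h1] := rZ t _ (e / 2 / (`|f| + 1)) (divr_gt0 e20 f0); first by rewrite t0.
move/subspace_continuousP : cc => /(_ t); rewrite /= in_itv/= tT => /(_ isT).
move=> /cvgrPdist_lt/(_ _ e20); rewrite near_withinE => /nbhs_ballP[d2 /= d20 h2].
have tm : t < Num.min T (t + Num.min d1 d2).
  by rewrite lt_min tltT ltrDl lt_min d10.
have [r] := rat_in_itvoo tm; rewrite in_itv/= => /andP[tr].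
rewrite lt_min => /andP[rT]; rewrite -ltrBlDl lt_min => /andP[rd1 rd2].
have rT' : 0 <= (ratr r : R) <= T by rewrite (le_trans t0) ltW.
have Zr := hr' _ _ erefl rT'.
have g1 : `|Z (ratr r) f - Z t f| <= e / 2.
  have := dual_normP f (chi_dual_sub (dZ (ratr r)) (dZ t)).
  rewrite /dsub => /le_trans; apply.
  have : dnorm (dsub (Z (ratr r)) (Z t)) <= e / 2 / (`|f| + 1).
    by rewrite ltW// h1// (ltW tr)/= -ltrBlDl.
  move=> /(ler_wpM2r (normr_ge0 f))/le_trans; apply.
  by rewrite mulrAC ler_pdivrMr// ler_pM2l// lerDl.
have g2 : `|c t - c (ratr r)| < e / 2.
  apply: h2; last by rewrite in_itv.
  by rewrite /ball/= ltr0_norm ?subr_lt0// opprB.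
rewrite (_ : Z t f - c t = - (Z (ratr r) f - Z t f) - (c t - c (ratr r))); last first.
  by rewrite Zr; ring.
by rewrite (le_trans (ler_normB _ _))// normrN (splitr e) lerD// ltW.
Qed.

(** * The chain rule for a fixed path *)

Section chain_rule.
Variables (R : realType) (B chi : normedModType R) (iota : chi -> B -> B -> R).
Variables (T : R) (F1 F2 : B -> R) (G : B -> B -> chi).
Hypotheses (T0 : 0 < T) (hchi : chi_subspace iota).
Hypotheses (dF1 : forall x, differentiable F1 x) (dF2 : forall x, differentiable F2 x).
Hypothesis iotaG : forall x y a c, iota (G x y) a c = 'd F1 x a * 'd F2 y c.
Hypothesis cG : continuous (fun p : B * B => G p.1 p.2).

Lemma comp_within_continuous (F : B -> R) (x : R -> B) :
  (forall z, differentiable F z) -> {within `[0, T], continuous x} ->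
  {within `[0, T], continuous (F \o x)}.
Proof.
move=> dF /subspace_continuousP cx; apply/subspace_continuousP => t tT.
have cF : F @ (x t) --> F (x t) by exact: differentiable_continuous.
exact: (cvg_comp _ _ (cx t tT) cF).
Qed.

Section pathwise.
Variables (x y : R -> B) (eps : nat -> R) (M : R).
Variables (Z : R -> chi -> R) (phi : nat -> chi).
Hypotheses (cx : {within `[0, T], continuous x})
  (cy : {within `[0, T], continuous y}).
Hypotheses (eps0 : forall n, 0 < eps n) (ceps : eps @ \oo --> (0 : R)).

Let dx n s := extT T x (s + eps n) - extT T x s.
Let dy n s := extT T y (s + eps n) - extT T y s.
Let N n s := dnorm (tens iota (dx n s) (dy n s)) / eps n.
Let D n s (f : chi) := iota f (dx n s) (dy n s) / eps n.
Let p n s := (extT T (F1 \o x) (s + eps n) - extT T (F1 \o x) s) *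
             (extT T (F2 \o y) (s + eps n) - extT T (F2 \o y) s) / eps n.
Let H s := G (x s) (y s).

Let T0' : 0 <= T. Proof. exact: ltW. Qed.

Let DN n s f : `|D n s f| <= N n s * `|f|.
Proof.
rewrite /D /N normrM normfV (gtr0_norm (eps0 n)) mulrAC ler_pM2r ?invr_gt0//.
exact: (dual_normP _ (tens_chi_dual hchi _ _)).
Qed.

Let N0 n s : 0 <= N n s.
Proof.
apply: divr_ge0; last exact: ltW.
by apply: dual_norm_ge0; exact: tens_chi_dual.
Qed.

Let DB n s f g : D n s (f - g) = D n s f - D n s g.
Proof.
rewrite /D -mulrBl; congr (_ / _).
exact: (chi_dualB _ _ (tens_chi_dual hchi _ _)).
Qed.

Let pD (e : R) : 0 < e -> exists2 del : R, 0 < del &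
  \forall n \near \oo, forall s u, 0 <= s <= T -> 0 <= u <= T ->
    `|s - u| < del -> `|p n s - D n s (H u)| <= e * N n s.
Proof.
move=> e0; have ex := extT_continuous T0' cx; have ey := extT_continuous T0' cy.
have cc : continuous (fun u => (extT T x u, extT T y u)).
  by move=> u; apply: cvg_pair; [exact: ex|exact: ey].
(* [d1] is the tolerance of [G] around the path of pairs. One half pays for the distance from the
   mean value point to the path at s (scale below [d2] and [d3]), the other for moving from s to
   u. *)
have [d1 d10 h1] := heine_segment 0 T cc cG e0.
have d120 : 0 < d1 / 2 by rewrite divr_gt0.
have cid : continuous (id : R -> R) by move=> u; exact: cvg_id.
have [d2 d20 h2] := heine_segment 0 T cid ex d120.
have [d3 d30 h3] := heine_segment 0 T cid ey d120.
have d0 : 0 < Num.min d2 d3 by rewrite lt_min d20.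
exists (Num.min d2 d3) => //.
have /cvgrPdist_lt/(_ _ d0) := ceps.
apply: filterS => n; rewrite sub0r normrN gtr0_norm// lt_min => /andP[n2 n3] s u sT uT.
rewrite lt_min => /andP[su2 su3].
have [c1 hc1 e1] := frechet_mean_value (extT T x s) (extT T x (s + eps n)) dF1.
have [c2 hc2 e2] := frechet_mean_value (extT T y s) (extT T y (s + eps n)) dF2.
have -> : p n s = D n s (G c1 c2).
  by rewrite /p /D iotaG /dx /dy -e1 -e2.
have qlt : `|G c1 c2 - H u| < e.
  rewrite /H -(extT_id x uT) -(extT_id y uT).
  apply: (h1 _ uT (c1, c2)); rewrite prod_normE /= gt_max; apply/andP; split.
    rewrite -(subrKA (extT T x s)) (le_lt_trans (ler_normD _ _))// (splitr d1) ltrD//.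
      by rewrite (le_lt_trans hc1)// h2// addrAC subrr add0r gtr0_norm.
    exact: h2.
  rewrite -(subrKA (extT T y s)) (le_lt_trans (ler_normD _ _))// (splitr d1) ltrD//.
    by rewrite (le_lt_trans hc2)// h3// addrAC subrr add0r gtr0_norm.
  exact: h3.
rewrite -DB (le_trans (DN _ _ _))// mulrC ler_wpM2r//; last exact: ltW.
Qed.

(** Deterministic form of the result. Density is asked over the whole range of [G], so that [phi]
    can be chosen before the path. *)
Lemma chain_rule_path :
  (forall n, tint T (fun s => dnorm (tens iota (extT T x (s + eps n) - extT T x s)
    (extT T y (s + eps n) - extT T y s)) / eps n) <= M) ->
  (forall t, in_chi_dual (Z t)) ->
  (forall a c (e : R), 0 < e -> exists m, `|G a c - phi m| < e) ->
  (forall m t, 0 <= t <= T ->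
    tint t (fun s => iota (phi m) (extT T x (s + eps n) - extT T x s)
      (extT T y (s + eps n) - extT T y s) / eps n) @[n --> \oo] --> Z t (phi m)) ->
  (forall m, {within `[0, T], continuous (fun t => Z t (phi m))}) ->
  exists q : R -> R,
  [/\ {within `[0, T], continuous q},
      (forall t, 0 <= t <= T -> tint t (p n) @[n --> \oo] --> q t) &
      (forall t, 0 <= t <= T -> is_RS_integral H Z t (q t))].
Proof.
move=> NM dZ dense DZ cZ.
have cdx n : continuous (dx n) by exact: extT_increment_continuous.
have cdy n : continuous (dy n) by exact: extT_increment_continuous.
apply: (@stieltjes_of_weak_limit R chi T M p N D H Z phi) => //.
- move=> n s; apply: cvgM; last exact: cvg_cst.
  by apply: cvgM; apply: extT_increment_continuous => //; exact: comp_within_continuous.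
- move=> n s; apply: cvgM; last exact: cvg_cst.
  exact: (dnorm_path_continuous hchi (@cdx n) (@cdy n)).
- move=> n f s; apply: cvgM; last exact: cvg_cst.
  exact: (iota_path_continuous hchi (@cdx n) (@cdy n)).
- by move=> t f g; exact: chi_dualB.
- by move=> t; exists (dnorm (Z t)) => f; exact: dual_normP.
- by move=> u _ e; exact: dense.
Qed.

End pathwise.
End chain_rule.

(** * Measurability from open sets, separability and subsequences *)

Lemma open_measurable_real (R : realType) (d : measure_display)
    (Omega : measurableType d) (f : Omega -> R) :
  (forall U : set R, open U -> measurable (f @^-1` U)) -> measurable_fun setT f.
Proof.
move=> h; apply: (measurability _ (RGenOpens.measurableE R)).
move=> _ [_ [a [b ->]] <-]; rewrite setTI; apply: h; exact: interval_open.
Qed.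

Lemma separable_seq (R : realType) (B : normedModType R) : separable_space B ->
  exists u : nat -> B, forall x (e : R), 0 < e -> exists n, `|x - u n| < e.
Proof.
move=> [D [cD dD]].
have /pfcard_geP[D0|[f]] : (D #<= [set: nat])%card := cD.
  have : closure D 0 by rewrite dD.
  by rewrite D0 closure0.
exists f => x e e0.
have : closure D x by rewrite dD.
move=> /(_ (ball x e) (nbhsx_ballx x e e0)) [z [Dz xz]].
have [n _ fn] := @surj _ _ _ _ f _ Dz.
by exists n; rewrite fn; move: xz; rewrite -ball_normE.
Qed.

Lemma increasing_ge_id (sig : nat -> nat) :
  (forall n, (sig n < sig n.+1)%N) -> forall n, (n <= sig n)%N.
Proof.
by move=> h; elim=> // n IH; exact: leq_ltn_trans (h n).
Qed.

Lemma cvg_subseq (R : realType) (u : nat -> R) (l : R) (sig : nat -> nat) :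
  (forall n, (n <= sig n)%N) -> u @ \oo --> l -> (fun n => u (sig n)) @ \oo --> l.
Proof.
move=> h ul A /ul [n _ hA]; exists n => // k /= nk.
by apply: hA; exact: leq_trans (h k).
Qed.

(** * Existence of the covariation on the probability space *)

Section covariation.
Variables (R : realType) (B chi : normedModType R) (iota : chi -> B -> B -> R).
Variables (d : measure_display) (Omega : measurableType d) (P : probability Omega R).
Variables (T : R) (X Y : Omega -> R -> B) (F1 F2 : B -> R) (G : B -> B -> chi).
Variable Z : Omega -> R -> chi -> R.
Hypotheses (T0 : 0 < T) (hB : separable_space B) (hchi : chi_subspace iota).
Hypotheses (dF1 : forall x, differentiable F1 x) (dF2 : forall x, differentiable F2 x).
Hypothesis iotaG : forall x y a c, iota (G x y) a c = 'd F1 x a * 'd F2 y c.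
Hypothesis cG : continuous (fun p : B * B => G p.1 p.2).
Hypotheses (cX : forall w, {within `[0, T], continuous (X w)})
  (cY : forall w, {within `[0, T], continuous (Y w)}).
Hypothesis hZ : is_chi_cov iota P T X Y Z.

Let T0' : 0 <= T. Proof. exact: ltW. Qed.

Let FX w t := F1 (X w t).
Let FY w t := F2 (Y w t).
Let H w s := G (X w s) (Y w s).

Let path_integral w (q : R -> R) :=
  {within `[0, T], continuous q} /\
  forall t, 0 <= t <= T -> is_RS_integral (H w) (Z w) t (q t).

(** [G] maps a countable dense set of pairs to a set dense in its range; separability of [B] thus
    replaces that of [chi]. Numbers coding no pair get the harmless value 0. *)
Lemma dense_range_seq : exists phi : nat -> chi,
  forall a c (e : R), 0 < e -> exists m, `|G a c - phi m| < e.
Proof.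
have [u hu] := separable_seq hB.
exists (fun m => if (unpickle m : option (nat * nat)) is Some (k, l)
  then G (u k) (u l) else 0) => a c e e0.
have /cvgrPdist_lt/(_ _ e0)/nbhs_ballP[r /= r0 hr] := @cG (a, c).
have [k hk] := hu a _ r0; have [l hl] := hu c _ r0.
exists (pickle (k, l)); rewrite pickleK; apply: (hr (u k, u l)).
by split; rewrite /= -ball_normE.
Qed.

(** (H1) bounds an extended real integral; its integrand is continuous, so the integral is finite
    and equals the real one. *)
Let tint_bound x y eps M : 0 < eps ->
  {within `[0, T], continuous x} -> {within `[0, T], continuous y} ->
  (\int[@lebesgue_measure R]_(s in itv0 T)
     (dnorm (tens iota (extT T x (s + eps) - extT T x s)
                       (extT T y (s + eps) - extT T y s)) / eps)%:E <= M%:E)%E ->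
  tint T (fun s => dnorm (tens iota (extT T x (s + eps) - extT T x s)
                       (extT T y (s + eps) - extT T y s)) / eps) <= M.
Proof.
move=> eps0 cx cy hM; rewrite -lee_fin /tint /Rintegral fineK//.
have cdx := @extT_increment_continuous R T T0' B x eps cx.
have cdy := @extT_increment_continuous R T T0' B y eps cy.
apply: integrable_fin_num => //; apply: continuous_integrable_segment => s.
apply: cvgM; last exact: cvg_cst.
exact: (dnorm_path_continuous hchi cdx cdy).
Qed.

Lemma ae_path_limit (eps : nat -> R) :
  (forall n, 0 < eps n) -> eps @ \oo --> (0 : R) ->
  exists sig : nat -> nat, {ae P, forall w, exists q, path_integral w q /\
    forall t, 0 <= t <= T ->
      real_cov_eps T FX FY (eps (sig k)) w t @[k --> \oo] --> q t}.
Proof.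
move=> eps0 ceps; have [H1 [C [cC [ucpC [dZ _ regZ ZC]]]]] := hZ.
have [phi hphi] := dense_range_seq.
have [sig1 [/increasing_ge_id sig1_ge hM]] := H1 _ eps0 ceps.
have [sig2 sig2_ge hC] := ucp0_ae_subseq (fun m => ucpC (phi m))
  (fun n => eps0 (sig1 n)) (cvg_subseq sig1_ge ceps).
(* Countably many test elements and rational times, so a single null set. *)
have hZC : {ae P, forall w, forall mr : nat * rat,
    Z w (Num.min T (Num.max 0 (ratr mr.2))) (phi mr.1) =
    C (phi mr.1) w (Num.min T (Num.max 0 (ratr mr.2)))}.
  by apply: ae_forall_countable => -[m r] /=; apply: ZC; exact: clip_itv.
(* [sig1] secures the bound of (H1) and [sig2] is chosen inside it, so the bound persists while the
   tested covariations converge almost surely. *)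
exists (sig1 \o sig2).
near=> w.
have [rZ _] : dual_cadlag T (Z w) /\ dual_bv T (Z w) by near: w.
have [M hMw] : exists M : R, forall k,
    (\int[@lebesgue_measure R]_(s in itv0 T)
      (dnorm (tens iota (extT T (X w) (s + eps (sig1 k)) - extT T (X w) s)
                   (extT T (Y w) (s + eps (sig1 k)) - extT T (Y w) s))
           / eps (sig1 k))%:E <= M%:E)%E by near: w.
have hCw : forall m t, 0 <= t <= T ->
    chi_cov_eps iota T X Y (phi m) (eps (sig1 (sig2 k))) w t @[k --> \oo] -->
    C (phi m) w t by near: w.
have hZCw : forall mr : nat * rat,
    Z w (Num.min T (Num.max 0 (ratr mr.2))) (phi mr.1) =
    C (phi mr.1) w (Num.min T (Num.max 0 (ratr mr.2))) by near: w.
have ZCw m t : 0 <= t <= T -> Z w t (phi m) = C (phi m) w t.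
  apply: (cadlag_eq_continuous T0 _ rZ) => // r; exact: (hZCw (m, r)).
have [|||||q [cq hq RSq]] := @chain_rule_path R B chi iota T F1 F2 G T0 hchi dF1 dF2
  iotaG cG (X w) (Y w) (fun k => eps (sig1 (sig2 k))) M (Z w) phi
  (@cX w) (@cY w) (fun k => eps0 _) (cvg_subseq sig2_ge (cvg_subseq sig1_ge ceps)) => //.
- by move=> k; apply: tint_bound.
- by move=> m t tT; rewrite ZCw//; exact: hCw.
- move=> m; have := cC (phi m) w; apply: subspace_eq_continuous => t.
  by rewrite inE/= in_itv/= => tT; rewrite /from_subspace ZCw.
- by exists q; split.
Unshelve. all: by end_near. Qed.

(* [Q] must not depend on the sequence of scales, so it is chosen through the
   Riemann-Stieltjes integral and not as a limit. *)
Let Q w : R -> R :=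
  if pselect (exists q, path_integral w q) is left e then projT1 (cid e) else fun=> 0.

Let QE w q t : path_integral w q -> 0 <= t <= T -> Q w t = q t.
Proof.
rewrite /Q => hq tT; case: pselect => [e|/(_ (ex_intro _ q hq))//].
case: (cid e) => q' /= [_ hq']; have [_ {}hq] := hq.
by have /andP[t0 _] := tT; apply: (is_RS_integral_uniq t0); [exact: hq'|exact: hq].
Qed.

Lemma measurable_real_cov_eps (eps t : R) :
  (forall s (U : set B), open U -> measurable [set w | U (X w s)]) ->
  (forall s (U : set B), open U -> measurable [set w | U (Y w s)]) ->
  0 <= t -> measurable_fun setT (fun w => real_cov_eps T FX FY eps w t).
Proof.
move=> mX mY t0.
have mF (F : B -> R) (V : Omega -> R -> B) s : (forall x, differentiable F x) ->
    (forall s (U : set B), open U -> measurable [set w | U (V w s)]) ->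
    measurable_fun setT (fun w => F (V w s)).
  move=> dF mV; apply: open_measurable_real => U oU.
  have cF : continuous F by move=> z; exact: differentiable_continuous.
  exact: (mV s (F @^-1` U) (open_comp (fun z _ => cF z) oU)).
apply: (@measurable_tint _ _ _ (fun w s =>
    (extT T (FX w) (s + eps) - extT T (FX w) s) *
    (extT T (FY w) (s + eps) - extT T (FY w) s) / eps) t t0) => [w s|s].
  apply: cvgM; last exact: cvg_cst.
  by apply: cvgM; apply: extT_increment_continuous => //;
    exact: comp_within_continuous.
apply: measurable_funM => //; apply: measurable_funM.
  by apply: measurable_funB; exact: (mF F1 X _ dF1 mX).
by apply: measurable_funB; exact: (mF F2 Y _ dF2 mY).
Qed.

(** [ae_path_limit] yields, for each sequence of scales, a limit that is a Riemann-Stieltjes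
    integral; uniqueness identifies it with [Q], and the subsequence criterion gives convergence in
    probability. *)
Lemma covariation_of_C1_functions :
  (forall s (U : set B), open U -> measurable [set w | U (X w s)]) ->
  (forall s (U : set B), open U -> measurable [set w | U (Y w s)]) ->
  exists Q : Omega -> R -> R, is_real_cov P T FX FY Q /\
    forall t, 0 <= t <= T ->
      {ae P, forall w, is_RS_integral (H w) (Z w) t (Q w t)}.
Proof.
move=> mX mY; exists Q; split; first split.
- move=> w; rewrite /Q; case: pselect => [e|_].
    by case: (cid e) => q [].
  (* Where no path integral exists [Q] is 0, so every path is continuous. *)
  by apply: continuous_subspaceT => x; exact: cvg_cst.
- move=> t tT; have /andP[t0 _] := tT; apply: cvg_prob0_subseq.
    by move=> eps _; exact: measurable_real_cov_eps.
  move=> eps eps0 ceps; have [sig hsig] := ae_path_limit eps0 ceps.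
  exists sig; apply: filterS hsig => w [q [hq cvq]].
  by rewrite (QE hq tT); exact: cvq.
- move=> t tT.
  (* One sequence of scales is enough to show that the integral exists almost surely. *)
  have eps0 n : (0 : R) < n.+1%:R^-1 by rewrite invr_gt0.
  have ceps : (fun n => n.+1%:R^-1) @ \oo --> (0 : R) by exact: cvg_harmonic.
  have [sig hsig] := ae_path_limit eps0 ceps.
  apply: filterS hsig => w [q [hq _]]; rewrite (QE hq tT).
  by have [_] := hq; exact.
Qed.

End covariation.

Unset Implicit Arguments.

(** As [iota] is injective, [G i j x y] is the unique element of [chi] representing the tensor of
    the two differentials, so giving [G] says that these tensors lie in [chi]. The formula is proved
    for every version [Z] of the [chi]-covariation. *)
Theorem theorem4p6 (R : realType) (B : completeNormedModType R)
    (chi : completeNormedModType R) (iota : chi -> B -> B -> R)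
    (d : measure_display) (Omega : measurableType d) (P : probability Omega R)
    (T : R) (X : 'I_2 -> Omega -> R -> B) (F : 'I_2 -> B -> R)
    (G : 'I_2 -> 'I_2 -> B -> B -> chi) :
  0 < T ->
  separable_space B ->
  chi_subspace iota ->
  (forall i t (U : set B), open U -> measurable [set w | U (X i w t)]) ->
  (forall i w, {within `[0, T], continuous (X i w)}) ->
  (forall i j, admits_chi_cov iota P T (X i) (X j)) ->
  (forall i, frechet_C1 (F i)) ->
  (forall i j x y a c, iota (G i j x y) a c = 'd (F i) x a * 'd (F j) y c) ->
  (forall i j, continuous (fun p : B * B => G i j p.1 p.2)) ->
  forall i j Z, is_chi_cov iota P T (X i) (X j) Z ->
  exists Q : Omega -> R -> R,
    is_real_cov P T (fun w t => F i (X i w t)) (fun w t => F j (X j w t)) Q /\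
    forall t, 0 <= t <= T ->
      {ae P, forall w,
        is_RS_integral (fun s => G i j (X i w s) (X j w s)) (Z w) t (Q w t)}.
Proof.
move=> T0 hB hchi mX cX _ hF iotaG cG i j Z hZ.
exact: (covariation_of_C1_functions T0 hB hchi (proj1 (hF i)) (proj1 (hF j))
  (iotaG i j) (cG i j) (cX i) (cX j) hZ (mX i) (mX j)).
Qed.
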